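(* Let $\epsilon>0$. Then the set $$\left\{m\in\mathbb{Z}^+ \;\middle|\; \mathsf{T}^{\left\lfloor\frac{\log_2 m}{1-\log_2\sqrt{3}}\right\rfloor}(m)\leq m^{\epsilon}\right\}$$ is of natural density $1$.
   Context: $\mathbb{Z}^+$ is the set of positive integers. The map $\mathsf{T}:\mathbb{Z}^+\to\mathbb{Z}^+$ is defined by $\mathsf{T}(m)=\frac{m}{2}$ if $m$ is even and $\mathsf{T}(m)=\frac{3m+1}{2}$ if $m$ is odd; $\mathsf{T}^k$ denotes its $k$-fold iterate ($\mathsf{T}^0$ is the identity). $\lfloor x\rfloor$ is the greatest integer $\leq x$. A set $A\subseteq\mathbb{Z}^+$ is of natural density $1$ if $\liminf_{n\to\infty}\frac{\#\{m\in A\mid m\leq n\}}{n}=1$. *)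

(* Defs.v *)
From HB Require Import structures.
From mathcomp Require Import all_boot all_order all_algebra finmap.
From mathcomp Require Import all_classical all_reals all_analysis.

Set Implicit Arguments.
Unset Strict Implicit.
Unset Printing Implicit Defensive.

Import Order.TTheory GRing.Theory Num.Theory.

Local Open Scope classical_set_scope.
Local Open Scope ring_scope.

(* Positive integers are the [m : nat] with [0 < m], a range which T preserves.
   Both halves are exact divisions. *)
Definition T (m : nat) : nat := if odd m then ((3 * m + 1)./2)%N else m./2.

Definition log2 {R : realType} (x : R) : R := ln x / ln 2.

(* Since 1 - log2 (sqrt 3) > 0, the quotient
   below is nonnegative for 0 < m, so the absolute value only converts the
   integer floor to a natural number. *)
Definition iterations (R : realType) (m : nat) : nat :=
  `|Num.floor (log2 (m%:R : R) / (1 - log2 (Num.sqrt 3)))|%N.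

Definition count_upto (A : set nat) (n : nat) : nat :=
  #|` fset_set [set m | A m /\ (m <= n)%N] |.

(* The term of index 0 has the junk value 0 and does not affect the liminf.
   The liminf is taken in the extended reals. *)
Definition natural_density_one (R : realType) (A : set nat) : Prop :=
  A `<=` [set m | (0 < m)%N] /\
  limn_einf (fun n : nat => ((count_upto A n)%:R / n%:R : R)%:E) = 1%:E.

(* Main.v *)
Require Import Defs.
From mathcomp Require Import all_boot all_order all_algebra finmap.
From mathcomp Require Import all_classical all_reals all_analysis.
From mathcomp Require Import zify ring lra.

Set Implicit Arguments.
Unset Strict Implicit.
Unset Printing Implicit Defensive.

Import Order.TTheory GRing.Theory Num.Theory.
Import numFieldNormedType.Exports.

Local Open Scope classical_set_scope.
Local Open Scope ring_scope.

(** Along the orbit of m write s_k for the number of odd terms among the first k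
    ([odd_steps]).  Then 2^k T^k(m) = 3^(s_k) m + c_k with an additive error c_k
    ([offset]) which depends on the parities alone.  If s_l stays within d/2 of
    l/2 for all l <= k ([balanced]), then c_k is at most about 3^d 2^k, so T^k(m)
    is about (sqrt 3 / 2)^k m up to factors exponential in d.  The number of
    iterations in the theorem is the k for which (sqrt 3 / 2)^k m is about 1.  So
    the theorem follows once it is known that, for every delta > 0, almost all
    m < 2^N are balanced with d = delta N up to that time, which is about 4.8 N
    ([mostly_balanced]).

    Up to time N this is classical: the first l parities of m depend on m modulo
    2^l only, all 2^l parity words occur exactly once ([sum_odd_steps] is the
    generating function form), and Chernoff's inequality makes a deviation
    delta N exponentially rare ([card_skewed_le]).  After time N the randomness
    of m is used up, and the parities to come are those of the number
    y = T^k(m).  For these to be balanced it is enough that T^k does not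
    concentrate many m on the few y < Y whose next parities are skewed, where
    Y, about (sqrt 3 / 2)^k 2^N, bounds the y that are reached.

    The heart of the proof is that the fibres of T^k are, up to factors
    exponential in d, as small as they can be on average: a given y has at most
    about (2 / sqrt 3)^k balanced preimages.  Indeed, cut the k steps into h
    steps followed by j steps, with 2^j slightly below 3^(k/2).  The residue of m
    modulo 2^h fixes the first h parities, hence T^h(m) modulo 3^(s_h).  From
    2^j y = 3^r T^h(m) + c, where r counts the odd steps among the last j, the
    residue of c modulo 3^(s_h + r) is then fixed too; and c, being roughly at
    most 2^j, is smaller than that modulus.  So y, r and m modulo 2^h determine
    m ([fibre_inj]), which leaves at most (j + 1) 2^h possibilities for m, and
    2^h is about (2 / sqrt 3)^k.

    Hence the m < 2^N that are balanced up to time k and skewed afterwards number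
    at most (skewed y < Y) times (2 / sqrt 3)^k, that is 2^N times the density of
    the skewed y, which beats the loss exponential in d as soon as d is a small
    enough multiple of N ([card_balanced_skewed]).  Windows of length N/q are then
    treated one after the other ([rarely_unbalanced]), each step demanding a much
    smaller deviation of the previous ones; the number of windows depends on
    delta only.  This works as long as Y exceeds 2^(N/q), and the few remaining
    steps cannot spoil the balance. *)

(** * Parities along an orbit *)

Definition odd_steps (k m : nat) : nat := (\sum_(i < k) odd (iter i T m))%N.

(** The additive error c_k of the header, that is the sum, over the odd steps
    i < k, of 2^i 3^(number of odd steps strictly between i and k). *)
Fixpoint offset (k m : nat) : nat :=
  if k is k'.+1 then
    if odd (iter k' T m) then (3 * offset k' m + 2 ^ k')%N else offset k' m
  else 0%N.

(** Deviations are measured on 2 s_l - l, so that the fair value l/2 needs no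
    rounding; the condition concerns every initial segment, because the bound on
    [offset] involves all final segments of the orbit. *)
Definition balanced (d k m : nat) : bool :=
  [forall l : 'I_k.+1,
    (2 * odd_steps l m <= l + d) && (l <= 2 * odd_steps l m + d)]%N.

Lemma T_shift m t : T (m + 2 * t) = (T m + 3 ^ odd m * t)%N.
Proof.
rewrite /T oddD oddM /= addbF.
by case: (odd m) => /=; lia.
Qed.

Lemma odd_steps0 m : odd_steps 0 m = 0%N.
Proof. by rewrite /odd_steps big_ord0. Qed.

Lemma odd_stepsS k m :
  odd_steps k.+1 m = (odd_steps k m + odd (iter k T m))%N.
Proof. by rewrite /odd_steps big_ord_recr. Qed.

Lemma odd_stepsD h j m :
  odd_steps (h + j) m = (odd_steps h m + odd_steps j (iter h T m))%N.
Proof.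
elim: j => [|j IH]; first by rewrite addn0 odd_steps0 addn0.
by rewrite addnS !odd_stepsS IH -addnA (addnC h) iterD.
Qed.

Lemma odd_steps_le k m : (odd_steps k m <= k)%N.
Proof.
elim: k => [|k IH]; first by rewrite odd_steps0.
by rewrite odd_stepsS; case: (odd _); lia.
Qed.

Lemma iter_T k m :
  (2 ^ k * iter k T m = 3 ^ odd_steps k m * m + offset k m)%N.
Proof.
elim: k => [|k IH]; first by rewrite odd_steps0 /=; lia.
rewrite odd_stepsS expnD iterS /= expnS.
have -> : (2 * 2 ^ k * T (iter k T m) = 2 ^ k * (2 * T (iter k T m)))%N by lia.
have -> : (2 * T (iter k T m) =
  if odd (iter k T m) then 3 * iter k T m + 1 else iter k T m)%N.
  by rewrite /T; case: ifP => o; lia.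
case: (odd _); last by rewrite muln1 IH.
by rewrite expn1 mulnDr mulnCA IH muln1; lia.
Qed.

(** Adding a multiple of 2^h leaves the first h parities unchanged, so both orbits
    undergo the same affine maps, and only the linear part acts on the
    difference. *)
Lemma iter_T_shift (h m t i : nat) : (i <= h)%N ->
  iter i T (m + 2 ^ h * t)%N =
    (iter i T m + 3 ^ odd_steps i m * 2 ^ (h - i) * t)%N /\
  odd_steps i (m + 2 ^ h * t) = odd_steps i m.
Proof.
elim: i => [|i IH] hi; first by rewrite /= !odd_steps0 subn0 mul1n.
have [IH1 IH2] := IH (ltnW hi).
have E : (3 ^ odd_steps i m * 2 ^ (h - i) * t =
          2 * (3 ^ odd_steps i m * 2 ^ (h - i.+1) * t))%N.
  have -> : (h - i = (h - i.+1).+1)%N by lia.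
  by rewrite expnS; lia.
rewrite !odd_stepsS IH2 !iterS IH1 E T_shift oddD oddM addbF.
by split=> //; rewrite expnD; lia.
Qed.

Lemma odd_steps_mod h m i : (i <= h)%N ->
  odd_steps i (m %% 2 ^ h) = odd_steps i m.
Proof.
move=> hi; rewrite [in RHS](divn_eq m (2 ^ h)) addnC mulnC.
by have [_ ->] := iter_T_shift (m %% 2 ^ h) (m %/ 2 ^ h) hi.
Qed.

(** * Balanced orbits *)

Lemma balancedP d k m :
  reflect (forall l, (l <= k)%N ->
    (2 * odd_steps l m <= l + d)%N /\ (l <= 2 * odd_steps l m + d)%N)
    (balanced d k m).
Proof.
apply: (iffP forallP) => H l.
  by move=> lk; have /andP := H (Ordinal (lk : l < k.+1)%N).
by apply/andP; apply: H; rewrite -ltnS.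
Qed.

(** A segment of the orbit is a difference of two initial segments, whence the
    doubled deviation. *)
Lemma balanced_tail d h j m :
  balanced d (h + j) m -> balanced (2 * d) j (iter h T m).
Proof.
move=> /balancedP H; apply/balancedP => l lj.
have := H (h + l)%N; have := H h; rewrite odd_stepsD; lia.
Qed.

(** Unlike [balanced], this is a condition on the single time l: only then does it
    depend on y modulo 2^l and have a density that Chernoff's inequality bounds. *)
Definition skewed (e l y : nat) : bool :=
  ~~ ((2 * odd_steps l y <= l + e) && (l <= 2 * odd_steps l y + e))%N.

(** The deviation of s_(k + l) is the sum of those of the first k steps and of the
    l steps that follow, so the latter must be responsible for an excess e. *)
Lemma skewed_window d e k w m : ~~ balanced (d + e) (k + w) m ->
  balanced d k m -> exists l : 'I_w.+1, skewed e l (iter k T m).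
Proof.
move=> nb /balancedP bal; apply/existsP; apply: contraNT nb.
rewrite negb_exists => /forallP H; apply/balancedP => l lkw.
have [lk|kl] := leqP l k; first by have := bal l lk; lia.
have lw : (l - k < w.+1)%N by lia.
have := H (Ordinal lw); rewrite negbK /= => /andP[].
have := bal k (leqnn k).
by rewrite -[in odd_steps l m](subnKC (ltnW kl)) odd_stepsD; lia.
Qed.

(** Each additional step changes 2 s_l - l by one. *)
Lemma balanced_extend d k K m :
  balanced d k m -> balanced (d + (K - k)) K m.
Proof.
move=> /balancedP bal; apply/balancedP => l lK.
have [lk|kl] := leqP l k; first by have := bal l lk; lia.
have := bal k (leqnn k); have := odd_steps_le (l - k) (iter k T m).
by rewrite -[in odd_steps l m](subnKC (ltnW kl)) odd_stepsD; lia.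
Qed.

Lemma balanced_sub d d' k k' m : (d <= d')%N -> (k' <= k)%N ->
  balanced d k m -> balanced d' k' m.
Proof.
move=> dd kk /balancedP bal; apply/balancedP => l lk.
by have := bal l (leq_trans lk kk); lia.
Qed.

(** * Fibres of the iterates of T *)

(** The congruence makes T^h m and T^h m' congruent modulo 3^(s_h).  As they
    reach the same number by j steps with equally many odd ones, their offsets are
    congruent modulo 3^(s_(h + j)); being smaller than this modulus, they are
    equal, and then so are T^h m and T^h m', and m and m'. *)
Lemma fibre_inj h j m m' :
  (offset j (iter h T m) < 3 ^ odd_steps (h + j) m)%N ->
  (offset j (iter h T m') < 3 ^ odd_steps (h + j) m')%N ->
  iter (h + j) T m = iter (h + j) T m' ->
  m = m' %[mod 2 ^ h] ->
  odd_steps j (iter h T m) = odd_steps j (iter h T m') -> m = m'.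
Proof.
move=> lt lt' eqT eqm eqs.
set r := (m %% 2 ^ h)%N in eqm.
have Em : m = (r + 2 ^ h * (m %/ 2 ^ h))%N by rewrite {1}(divn_eq m (2 ^ h)); lia.
have Em' : m' = (r + 2 ^ h * (m' %/ 2 ^ h))%N.
  by rewrite {1}(divn_eq m' (2 ^ h)) -eqm; lia.
move: (m %/ 2 ^ h)%N (m' %/ 2 ^ h)%N Em Em' => t t' Em Em'.
have [A1 A2] := iter_T_shift r t (leqnn h).
have [B1 B2] := iter_T_shift r t' (leqnn h).
rewrite -Em subnn muln1 in A1 A2; rewrite -Em' subnn muln1 in B1 B2.
have I := iter_T j (iter h T m); have I' := iter_T j (iter h T m').
rewrite -iterD addnC in I; rewrite -iterD addnC -eqT -eqs in I'.
rewrite !odd_stepsD -eqs in lt lt'.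
set s := odd_steps j _ in eqs I I' lt lt'.
rewrite A2 expnD in lt; rewrite B2 expnD in lt'.
rewrite I in I'; move: (offset _ _) (offset _ _) lt lt' I' => c' c lt lt' I'.
have E : (t * (3 ^ odd_steps h r * 3 ^ s) + c =
          t' * (3 ^ odd_steps h r * 3 ^ s) + c')%N.
  by move: I'; rewrite A1 B1; move: (3 ^ s)%N (3 ^ _)%N; lia.
suff tt : t = t' by rewrite Em Em' tt.
have := congr1 (divn^~ (3 ^ odd_steps h r * 3 ^ s)%N) E.
by rewrite /= !divnMDl ?(leq_ltn_trans _ lt) // !divn_small // !addn0.
Qed.

(** By [fibre_inj], m is determined by its residue modulo 2^h, the number of odd
    steps among the last j, and the number y = T^(h + j) m.  The factor
    Q.+1 * #|E| counts the possible y through their quotient and remainder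
    modulo 2^l. *)
Lemma card_landing_le (M h j l Q : nat) (P E : pred nat) :
  (forall y, E (y %% 2 ^ l)%N = E y) ->
  (forall m, (m < M)%N -> P m ->
    [/\ (offset j (iter h T m) < 3 ^ odd_steps (h + j) m)%N,
        (iter (h + j) T m < Q.+1 * 2 ^ l)%N & E (iter (h + j) T m)]) ->
  (#|[set m : 'I_M | P m]%SET| <=
     Q.+1 * #|[set r : 'I_(2 ^ l) | E r]%SET| * 2 ^ h * j.+1)%N.
Proof.
move=> Emod HP.
have lt k y : (y %% 2 ^ k < 2 ^ k)%N by rewrite ltn_pmod ?expn_gt0.
pose f (m : 'I_M) := (inord (iter (h + j) T m %/ 2 ^ l) : 'I_Q.+1,
  Ordinal (lt l (iter (h + j) T m)), Ordinal (lt h m),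
  inord (odd_steps j (iter h T m)) : 'I_j.+1).
have finj : {in [set m : 'I_M | P m]%SET &, injective f}.
  move=> m m'; rewrite !inE => Pm Pm'.
  have [lo lq _] := HP _ (ltn_ord m) Pm.
  have [lo' lq' _] := HP _ (ltn_ord m') Pm'.
  rewrite -!ltn_divLR ?expn_gt0 // in lq lq'.
  case=> /(congr1 val) /= + eT em /(congr1 val) /=.
  rewrite !inordK ?ltnS ?odd_steps_le // => eq es.
  apply: val_inj; apply: (fibre_inj lo lo') => //.
  by rewrite (divn_eq (iter (h + j) T m) (2 ^ l)) eq eT -divn_eq.
rewrite -(card_in_imset finj).
have -> : (Q.+1 * #|[set r : 'I_(2 ^ l) | E r]%SET| * 2 ^ h * j.+1 =
  #|finset.setX (finset.setX (finset.setX [set: 'I_Q.+1]%SET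
      [set r : 'I_(2 ^ l) | E r]%SET) [set: 'I_(2 ^ h)]%SET)
      [set: 'I_j.+1]%SET|)%N.
  by rewrite !cardsX !cardsT !card_ord.
apply: subset_leq_card; apply/fintype.subsetP => _ /imsetP[m Pm ->].
rewrite inE in Pm; have [_ _ Em] := HP _ (ltn_ord m) Pm.
by rewrite !inE /= Emod Em.
Qed.

(** * Large deviations of the number of odd steps *)

(** Among the two lifts modulo 2^(l + 1) of a residue r modulo 2^l, one makes the
    step number l odd and the other one makes it even: the values of T^l at the
    lifts differ by a power of 3.  Hence every word of l parities occurs exactly
    once, and the sum is a binomial expansion. *)
Lemma sum_odd_steps (R : comNzRingType) (u v : R) l :
  \sum_(0 <= r < 2 ^ l) u ^+ odd_steps l r * v ^+ (l - odd_steps l r) =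
  (u + v) ^+ l.
Proof.
elim: l => [|l IH]; first by rewrite expn0 big_nat1 odd_steps0 !expr0 mulr1.
rewrite expnS mul2n -addnn (@big_cat_nat _ _ _ (2 ^ l)) ?leq_addr //=.
rewrite -[X in _ + \big[_/_]_(X <= _ < _) _]add0n big_addn addnK -big_split /= exprSr -IH.
rewrite big_distrl /=; apply: eq_bigr => r _.
(* r + 2^l is the second lift of r *)
have [E1 E2] := iter_T_shift r 1 (leqnn l).
rewrite muln1 subnn muln1 in E1 E2.
rewrite !odd_stepsS E1 E2 oddD muln1 oddX /= orbT addbT.
have := odd_steps_le l r; set s := odd_steps l r => sl.
have F : (l.+1 - s = (l - s).+1)%N by lia.
by case: (odd _) => /=; rewrite !addn0 !addn1 subSS F !exprSr; ring.
Qed.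

(** From exp x <= 1 / (1 - x) and exp (- x) <= 1 / (1 + x) the left-hand side is at
    most 2 / (1 - x^2), and 1 / (1 - x^2) <= 1 + 2 x^2 when x^2 <= 1/2. *)
Lemma expR_cosh_le (R : realType) (x : R) : 0 <= x -> 2 * x <= 1 ->
  expR x + expR (- x) <= 2 * expR (2 * x ^+ 2).
Proof.
move=> x0 x1.
have A : (1 - x) * expR x <= 1.
  rewrite -[leRHS](expRxMexpNx_1 x) mulrC ler_wpM2l ?expR_ge0 //.
  exact: expR_ge1Dx.
have B : (1 + x) * expR (- x) <= 1.
  rewrite -[leRHS](expRxMexpNx_1 x) ler_wpM2r ?expR_ge0 //.
  exact: expR_ge1Dx.
have C : 1 + 2 * x ^+ 2 <= expR (2 * x ^+ 2) by exact: expR_ge1Dx.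
have := expR_gt0 x; have := expR_gt0 (- x).
move: (expR x) (expR (- x)) (expR (2 * x ^+ 2)) A B C => a b c A B C b0 a0.
have x2 : 0 < 1 - x ^+ 2 by nra.
rewrite -(ler_pM2l x2).
have D : (1 - x ^+ 2) * (a + b) <= 2.
  have -> : (1 - x ^+ 2) * (a + b) =
    (1 + x) * ((1 - x) * a) + (1 - x) * ((1 + x) * b) by ring.
  have -> : 2 = (1 + x) * 1 + (1 - x) * 1 :> R by ring.
  by apply: lerD; apply: ler_wpM2l => //; lra.
apply: (le_trans D); have : (1 - x ^+ 2) * (1 + 2 * x ^+ 2) <= (1 - x ^+ 2) * c.
  by rewrite ler_wpM2l // ltW.
have : 0 <= x ^+ 2 * (1 - 2 * x ^+ 2) by rewrite mulr_ge0 ?sqr_ge0 //; nra.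
by lra.
Qed.

(** Chernoff's inequality with parameter x, for both signs of the deviation at
    once. *)
Lemma card_skewed_le (R : realType) (x : R) (e l : nat) :
  0 <= x -> 2 * x <= 1 ->
  #|[set r : 'I_(2 ^ l) | skewed e l r]%SET|%:R <=
    2 ^+ l.+1 * expR (2 * x ^+ 2 * l%:R - x * e%:R).
Proof.
move=> x0 x1.
rewrite -sum1_card natr_sum.
(* F r is exp (x (2 s - l) - x e) + exp (x (l - 2 s) - x e); it dominates the
   indicator of a skewed r, and sum_odd_steps sums both of its terms. *)
pose F r := (expR x ^+ odd_steps l r * expR (- x) ^+ (l - odd_steps l r)
  + expR (- x) ^+ odd_steps l r * expR x ^+ (l - odd_steps l r))
  * expR (- (x * e%:R)).
have H (r : nat) : skewed e l r -> 1 <= F r.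
  rewrite /F; have := odd_steps_le l r; rewrite /skewed.
  move: (odd_steps l r) => s sl; rewrite negb_and -!ltnNge => sk.
  rewrite -!expRM_natl -!expRD mulrDl -!expRD.
  case/orP: sk => sk.
    apply: ler_wpDr; first exact: expR_ge0.
    rewrite -[leLHS]expR0 ler_expR natrB //.
    have : (l + e)%:R <= (2 * s)%:R :> R by rewrite ler_nat ltnW.
    by rewrite natrD natrM; nra.
  apply: ler_wpDl; first exact: expR_ge0.
  rewrite -[leLHS]expR0 ler_expR natrB //.
  have : (2 * s + e)%:R <= l%:R :> R by rewrite ler_nat ltnW.
  by rewrite natrD natrM; nra.
apply: (@le_trans _ _ (\sum_(0 <= r < 2 ^ l) F r)).
  rewrite big_mkord.
  apply: (@le_trans _ _ (\sum_(r in [set r : 'I_(2 ^ l) | skewed e l r]%SET) F r)).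
    by apply: ler_sum => r; rewrite inE; exact: H.
  rewrite [leRHS](bigID (fun r : 'I_(2 ^ l) => r \in [set r : 'I_(2 ^ l) | skewed e l r]%SET)) /=.
  rewrite lerDl sumr_ge0 // => r _.
  by rewrite mulr_ge0 ?addr_ge0 ?mulr_ge0 ?exprn_ge0 ?expR_ge0.
rewrite -big_distrl big_split /= !sum_odd_steps expRD mulrA.
rewrite ler_wpM2r ?expR_ge0 // [expR (- x) + _]addrC -mulr2n.
rewrite -[leLHS]mulr_natl exprS -[leRHS]mulrA ler_wpM2l //.
rewrite [_ * l%:R]mulrC expRM_natl -exprMn.
by rewrite lerXn2r ?nnegrE ?addr_ge0 ?mulr_ge0 ?expR_ge0 // expR_cosh_le.
Qed.

(** * Size of a balanced orbit *)

Section RealBounds.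
Variable R : realType.
Local Notation L := (Num.sqrt (3 : R)).

Lemma sqr_sqrt3 : L ^+ 2 = 3. Proof. by rewrite sqr_sqrtr. Qed.

Lemma sqrt3_ge0 : 0 <= L. Proof. exact: sqrtr_ge0. Qed.

Lemma sqrt3_bounds : 3 / 2 < L <= 7 / 4.
Proof. by have := sqr_sqrt3; have := sqrt3_ge0; nra. Qed.

Lemma sqrt3_ge1 : 1 <= L.
Proof. by have := sqrt3_bounds; lra. Qed.

Lemma sqrt3_gt0 : 0 < L.
Proof. exact: lt_le_trans ltr01 sqrt3_ge1. Qed.

Lemma sqrt3X_le2X n : L ^+ n <= 2 ^+ n.
Proof. by rewrite lerXn2r ?nnegrE ?sqrt3_ge0 //; have := sqrt3_bounds; lra. Qed.

Lemma sqrt3X_le3X n : L ^+ n <= 3 ^+ n.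
Proof. by rewrite lerXn2r ?nnegrE ?sqrt3_ge0 //; have := sqrt3_bounds; lra. Qed.

(** Powers of L = sqrt 3 absorb the factor 2 of [balanced]: 3^s = L^(2 s). *)
Lemma exp_odd_steps_bounds d k m l : balanced d k m -> (l <= k)%N ->
  L ^+ l <= L ^+ d * 3 ^+ odd_steps l m /\ 3 ^+ odd_steps l m <= L ^+ (l + d).
Proof.
move=> /balancedP H /H [H1 H2].
have -> : 3 ^+ odd_steps l m = L ^+ (2 * odd_steps l m) by rewrite exprM sqr_sqrt3.
by rewrite -exprD !ler_weXn2l ?sqrt3_ge1 //; lia.
Qed.

(** An odd step i contributes 2^i 3^(s_j - s_(i + 1)) to the offset, which is at
    most 2^i L^(j - i - 1 + 2 d).  The sum is geometric of ratio 2 / L > 1, so its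
    last terms dominate: it is at most 3^d 2^j / (2 - L). *)
Lemma offset_le d j z : balanced d j z ->
  (offset j z)%:R <= 4 * 3 ^+ d * 2 ^+ j :> R.
Proof.
move=> bal; have L0 := sqrt3_gt0.
have Lb := sqrt3_bounds.
(* The offset divided by 3^(s_i) only increases, by 2^i / 3^(s_(i + 1)) at an odd
   step; it is compared with the geometric sequence (2 / L)^i. The constant 4 is
   chosen so that 4 (2 - L) >= 1. *)
suff H i : (i <= j)%N -> (offset i z)%:R * L ^+ i <=
    4 * 3 ^+ odd_steps i z * L ^+ d * 2 ^+ i.
  rewrite -(ler_pM2r (exprn_gt0 j L0)); apply: (le_trans (H j (leqnn j))).
  have [_ B] := exp_odd_steps_bounds bal (leqnn j).
  have -> : 3 ^+ d = L ^+ d * L ^+ d :> R by rewrite -exprMn -expr2 sqr_sqrt3.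
  have := ler_wpM2l (_ : 0 <= 4 * L ^+ d * 2 ^+ j) B.
  rewrite !mulr_ge0 ?exprn_ge0 ?sqrt3_ge0 // exprD => /(_ isT) {B}B.
  by apply: le_trans (le_trans B _); rewrite le_eqVlt; apply/orP; left; apply/eqP; ring.
elim: i => [|i IH] ij; first by rewrite mul0r !mulr_ge0 ?exprn_ge0 ?sqrt3_ge0.
have {}IH := IH (ltnW ij).
have [B _] := exp_odd_steps_bounds bal ij.
rewrite odd_stepsS in B *; rewrite /=; case: ifP => o; rewrite o /= in B *.
- rewrite addn1 in B *; rewrite natrD natrM natrX mulrDl.
  have {}B := ler_wpM2l (_ : 0 <= 2 ^+ i) B.
  have {}B : 2 ^+ i * L ^+ i.+1 <=
      2 ^+ i * (L ^+ d * 3 ^+ (odd_steps i z).+1) by apply: B; rewrite exprn_ge0.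
  have P : 0 <= 2 ^+ i * (L ^+ d * 3 ^+ odd_steps i z).
    by rewrite !mulr_ge0 ?exprn_ge0 ?sqrt3_ge0.
  rewrite !exprS in B *.
  move: (_%:R) (L ^+ i) (3 ^+ odd_steps i z) (L ^+ d) (2 ^+ i) IH B P.
  move=> c p s q t IH B P.
  have := ler_wpM2l (ltW L0) IH.
  nra.
- rewrite addn0 !exprS.
  have P : 0 <= 4 * 3 ^+ odd_steps i z * L ^+ d * 2 ^+ i.
    by rewrite !mulr_ge0 ?exprn_ge0 ?sqrt3_ge0.
  have := ler_wpM2l (ltW L0) IH.
  move: (_%:R) (L ^+ i) P => c p P; nra.
Qed.

Lemma iter_T_le d k m : balanced d k m ->
  2 ^+ k * (iter k T m)%:R <= L ^+ (k + d) * m%:R + 4 * 3 ^+ d * 2 ^+ k :> R.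
Proof.
move=> bal; rewrite -natrX -natrM iter_T natrD natrM natrX natrX.
have [_ B] := exp_odd_steps_bounds bal (leqnn k).
by rewrite lerD ?offset_le // ler_wpM2r.
Qed.

(** The cut of the k steps used with [card_landing_le]: 2^j has to stay below
    L^k 27^(-d) for the offset of the last j steps to be smaller than 3^(s_k), but
    within a constant factor of it, so that h = k - j is as small as possible.
    For j = 0 the offset vanishes and no bound is required. *)
Lemma fibre_split d k : exists h j, [/\ (h + j = k)%N,
  j = 0%N \/ 4 * 27 ^+ d * 2 ^+ j < L ^+ k & L ^+ k <= 8 * 27 ^+ d * 2 ^+ j].
Proof.
have one27 : 1 <= 27 ^+ d :> R by rewrite exprn_ege1 // ler1n.
have Lk : L ^+ k <= 8 * 27 ^+ d * 2 ^+ k.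
  have := sqrt3X_le2X k.
  have : 0 <= 2 ^+ k :> R by rewrite exprn_ge0.
  move: (L ^+ k) (2 ^+ k) (27 ^+ d) one27 => a b c; nra.
have ex : exists j, L ^+ k <= 8 * 27 ^+ d * 2 ^+ j by exists k.
case: (ex_minnP ex) => j Hj minj.
exists (k - j)%N, j; split=> //; first by rewrite subnK // minj.
case: j => [|j] in Hj minj *; first by left.
right; rewrite ltNge; apply/negP => le.
suff /minj : L ^+ k <= 8 * 27 ^+ d * 2 ^+ j by rewrite ltnn.
rewrite exprS in le; apply: (le_trans le); rewrite le_eqVlt; apply/orP; left; apply/eqP; ring.
Qed.

(** Here X = (L / 2)^k 2^N is the typical size of T^k m.  The T^k m lie below
    5 * 3^d X, the proportion of skewed numbers is at most
    2 exp (2 x^2 w - x e), and each has at most (k + 1) 2^h balanced preimages,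
    where 2^h X <= 8 * 27^d 2^N.  The
    hypothesis on k + w says that X >= 2^w, so that the residues modulo 2^l are
    evenly distributed below X. *)
Lemma card_balanced_skewed d e k l w N (x : R) :
  (l <= w)%N -> 2 ^+ (k + w) <= L ^+ k * 2 ^+ N -> 0 <= x -> 2 * x <= 1 ->
  #|[set m : 'I_(2 ^ N) | balanced d k m && skewed e l (iter k T m)]%SET|%:R <=
    96 * k.+1%:R * 81 ^+ d * 2 ^+ N * expR (2 * x ^+ 2 * w%:R - x * e%:R).
Proof.
move=> lw sz x0 x1.
have L0 := sqrt3_gt0.
have [h [j [hj j_small j_large]]] := fibre_split d k.
pose X : R := L ^+ k * 2 ^+ N / 2 ^+ k.
have p2 n : 0 < 2 ^+ n :> R by rewrite exprn_gt0.
have XE : 2 ^+ k * X = L ^+ k * 2 ^+ N by rewrite /X mulrC divfK // gt_eqF.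
have X2 : 2 ^+ w <= X by rewrite -(ler_pM2l (p2 k)) XE -exprD.
have one2 n : 1 <= 2 ^+ n :> R by rewrite exprn_ege1 // ler1n.
have one3 : 1 <= 3 ^+ d :> R by rewrite exprn_ege1 // ler1n.
have X2l : 2 ^+ l <= X by apply: le_trans X2; rewrite ler_weXn2l // ler1n.
have X1 : 1 <= X by apply: le_trans X2l.
pose Q := Num.trunc (5 * 3 ^+ d * X / 2 ^+ l).
have Qge0 : 0 <= 5 * 3 ^+ d * X / 2 ^+ l.
  by rewrite divr_ge0 ?(ltW (p2 _)) // !mulr_ge0 ?exprn_ge0 //; lra.
have Ld := sqrt3X_le3X d.
have Q_gt : 5 * 3 ^+ d * X < (Q.+1)%:R * 2 ^+ l.
  by rewrite -ltr_pdivrMr // truncnS_gt.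
have Q_le : (Q.+1)%:R <= 6 * 3 ^+ d * X / 2 ^+ l.
  rewrite -natr1; have : Q%:R <= 5 * 3 ^+ d * X / 2 ^+ l by rewrite truncn_le.
  rewrite !ler_pdivlMr //; move: (3 ^+ d) one3 => a a1.
  move: Q%:R (2 ^+ l) X2l => q b; nra.
have main := @card_landing_le (2 ^ N) h j l Q
  (fun m => balanced d k m && skewed e l (iter k T m)) (skewed e l).
have {main} : (#|[set m : 'I_(2 ^ N) | balanced d k m &&
    skewed e l (iter k T m)]%SET| <=
    Q.+1 * #|[set r : 'I_(2 ^ l) | skewed e l r]%SET| * 2 ^ h * j.+1)%N.
  apply: main => [y|m mN /andP[bal sk]]; first by rewrite /skewed odd_steps_mod.
  rewrite hj; split=> //.
  - case: j_small => [->|j_small]; first by rewrite expn_gt0.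
    rewrite -(ltr_nat R) natrX; rewrite -hj in bal.
    apply: le_lt_trans (offset_le (balanced_tail bal)) _.
    rewrite hj in bal.
    have [B _] := exp_odd_steps_bounds bal (leqnn k).
    have Ldp : 0 < L ^+ d by rewrite exprn_gt0.
    rewrite -(ltr_pM2l Ldp); apply: lt_le_trans B; apply: le_lt_trans j_small.
    have -> : 27 ^+ d = 3 ^+ d * 3 ^+ (2 * d) :> R.
      by rewrite exprM -exprMn; congr (_ ^+ _); ring.
    move: (3 ^+ (2 * d)) (2 ^+ j) (exprn_ge0 (2 * d) (ler0n R 3)) (ltW (p2 j)).
    move=> a b a0 b0; have ab : 0 <= a * b by rewrite mulr_ge0.
    by have := ler_wpM2r ab Ld; nra.
  - rewrite -(ltr_nat R) natrM natrX; apply: le_lt_trans Q_gt.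
    rewrite -(ler_pM2l (p2 k)); apply: (le_trans (iter_T_le bal)).
    have mN' : m%:R <= 2 ^+ N :> R by rewrite -natrX ler_nat ltnW.
    have Lkd : 0 <= L ^+ (k + d) by rewrite exprn_ge0 // ltW.
    have U : L ^+ (k + d) * m%:R <= 2 ^+ k * X * L ^+ d.
      by rewrite XE mulrAC -exprD ler_wpM2l.
    have U2 : 2 ^+ k * X * L ^+ d <= 2 ^+ k * X * 3 ^+ d.
      by rewrite ler_wpM2l // mulr_ge0 ?ltW //; lra.
    have U3 : 2 ^+ k * 3 ^+ d * 1 <= 2 ^+ k * 3 ^+ d * X.
      by rewrite ler_wpM2l // mulr_ge0 ?ltW //; lra.
    by lra.
rewrite -(ler_nat R) !natrM natrX => main; apply: (le_trans main).
have S := card_skewed_le e l x0 x1.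
have E : expR (2 * x ^+ 2 * l%:R - x * e%:R) <= expR (2 * x ^+ 2 * w%:R - x * e%:R).
  by rewrite ler_expR lerD2r ler_wpM2l ?ler_nat // mulr_ge0 ?sqr_ge0.
have {E}S := le_trans S (ler_wpM2l (ltW (p2 _)) E).
have Lk0 : 0 < L ^+ k by rewrite exprn_gt0.
have H : 2 ^+ h <= 8 * 27 ^+ d * 2 ^+ k / L ^+ k.
  rewrite ler_pdivlMr // -hj [in 2 ^+ (h + j)]exprD hj.
  by have := ler_wpM2l (ltW (p2 h)) j_large; lra.
have J : (j.+1)%:R <= (k.+1)%:R :> R by rewrite ler_nat ltnS -hj leq_addl.
have h0 : 0 <= 2 ^+ h :> R by rewrite ltW.
apply: (le_trans (ler_pM _ _ (ler_pM _ _ (ler_pM _ _ Q_le S) H) J)) => //.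
have -> : 81 ^+ d = 3 ^+ d * 27 ^+ d :> R by rewrite -exprMn; congr (_ ^+ _); ring.
rewrite le_eqVlt; apply/orP; left; apply/eqP.
rewrite /X exprS; field.
by rewrite !gt_eqF.
Qed.

(** * Almost every orbit stays balanced *)

Definition unbalanced_count (d k N : nat) : nat :=
  #|[set m : 'I_(2 ^ N) | ~~ balanced d k m]%SET|.

Lemma unbalanced_count_step d e k w N (x : R) :
  2 ^+ (k + w) <= L ^+ k * 2 ^+ N -> 0 <= x -> 2 * x <= 1 ->
  (unbalanced_count (d + e) (k + w) N)%:R <= (unbalanced_count d k N)%:R +
    w.+1%:R * (96 * k.+1%:R * 81 ^+ d * 2 ^+ N *
               expR (2 * x ^+ 2 * w%:R - x * e%:R)).
Proof.
move=> sz x0 x1.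
pose S (l : 'I_w.+1) := [set m : 'I_(2 ^ N) |
  balanced d k m && skewed e l (iter k T m)]%SET.
have : (unbalanced_count (d + e) (k + w) N <=
    unbalanced_count d k N + \sum_(l < w.+1) #|S l|)%N.
  apply: leq_trans (leq_add (leqnn _) (unstable.card_big_setU _ _ _)).
  apply: leq_trans (leq_card_setU _ _).1.
  apply: subset_leq_card; apply/fintype.subsetP => m; rewrite !inE => nb.
  have [bal /=|//] := boolP (balanced d k m).
  have [l sk] := skewed_window nb bal.
  by apply/bigcupP; exists l => //; rewrite inE bal.
rewrite -(ler_nat R) natrD natr_sum => /le_trans; apply.
rewrite lerD2l mulr_natl -[X in _ *+ X](card_ord w.+1) -sumr_const.
apply: ler_sum => l _; apply: card_balanced_skewed => //.
by rewrite -ltnS.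
Qed.

(** The exponential dominates its Taylor term of degree 3. *)
Lemma near_sqr_expR_le (C c r : R) : 0 <= C -> 0 < c -> 0 < r ->
  \forall N \near \oo, C * N.+1%:R ^+ 2 * expR (- (c * N%:R)) <= r.
Proof.
move=> C0 c0 r0.
near=> N.
have N1 : 1 <= N%:R :> R by near: N; exact: nbhs_infty_ger.
have N2 : 24 * C / (r * c ^+ 3) <= N%:R by near: N; exact: nbhs_infty_ger.
have c3 : 0 < c ^+ 3 by rewrite exprn_gt0.
rewrite expRN ler_pdivrMr ?expR_gt0 //.
have := @expR_ge1Dxn _ (c * N%:R) 2 (mulr_ge0 (ltW c0) (ler0n _ _)).
rewrite (_ : 3`!%:R = 6) // => E.
apply: (@le_trans _ _ (r * ((c * N%:R) ^+ 3 / 6))); last first.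
  by rewrite ler_wpM2l ?(ltW r0) //; apply: le_trans E; lra.
rewrite ler_pdivrMr ?mulr_gt0 // in N2.
rewrite -natr1 exprMn.
have : (N%:R + 1) ^+ 2 <= 4 * N%:R ^+ 2 :> R by nra.
move=> /(ler_wpM2l C0) /le_trans; apply.
have := ler_wpM2r (sqr_ge0 (N%:R : R)) N2.
by rewrite ![_ ^+ 3]exprS; lra.
Unshelve. all: by end_near.
Qed.

(** Induction on the number i of windows of length N/q.  With deviation parameter
    del' for the first i windows, the fibres cost a factor 81^(del' N), while a
    deviation of del/2 N in the next window has probability about exp (- c N) with c of
    order del^2 for small del; so del' is taken small compared with c.  The condition on i'
    says that (L / 2)^(i' N / q) 2^N is still at least 2^(N / q), that is, T^k m
    is typically large enough to make the parities of the next window random. *)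
Lemma rarely_unbalanced q i :
  (0 < q)%N -> (forall i', (i' < i)%N -> 2 ^+ i' <= L ^+ i' * 2 ^+ q.-1) ->
  forall del r : R, 0 < del -> 0 < r -> \forall N \near \oo,
    (unbalanced_count (Num.trunc (del * N%:R)) (i * (N %/ q)) N)%:R
      <= r * 2 ^+ N.
Proof.
move=> q0; elim: i => [|i IH] sz del r del0 r0.
  near=> N; rewrite mul0n.
  rewrite (_ : unbalanced_count _ _ _ = 0%N) ?mulr_ge0 ?exprn_ge0 ?(ltW r0) //.
  apply/eqP; rewrite cards_eq0; apply/eqP/setP => m; rewrite !inE.
  apply: negbTE; rewrite negbK; apply/balancedP => l.
  by rewrite leqn0 => /eqP->; rewrite odd_steps0.
(* With w <= N and e close to at least del N / 2, the exponent 2 x^2 w - x e is at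
   most 1 - c N. *)
pose x := Num.min (1 / 2) (del / 8).
have x0 : 0 < x by rewrite lt_min; apply/andP; split; lra.
have xh : x <= 1 / 2 by rewrite ge_min lexx.
have x1 : 2 * x <= 1 by lra.
have x2 : x <= del / 8 by rewrite ge_min lexx orbT.
pose c := x * del / 4; have c0 : 0 < c by rewrite !mulr_gt0.
(* 81 <= exp 80, so 81^(del' N) <= exp (c N / 2) *)
pose del' := Num.min (del / 2) (c / 160).
have d0 : 0 < del' by rewrite lt_min; apply/andP; split; lra.
have d1 : del' <= del / 2 by rewrite ge_min lexx.
have d2 : del' <= c / 160 by rewrite ge_min lexx orbT.
have {}IH := IH (fun i' h => sz i' (ltnW h)) _ (r / 2) d0 (divr_gt0 r0 (ltr0Sn _ 1)).
have C0 : 0 <= 96 * i.+1%:R * expR 1 :> R by rewrite !mulr_ge0 ?expR_ge0.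
have E := near_sqr_expR_le C0 (divr_gt0 c0 (ltr0Sn _ 1)) (divr_gt0 r0 (ltr0Sn _ 1)).
near=> N.
have H1 : (unbalanced_count (Num.trunc (del' * N%:R)) (i * (N %/ q)) N)%:R
      <= r / 2 * 2 ^+ N by near: N; exact: IH.
have H2 : 96 * i.+1%:R * expR 1 * N.+1%:R ^+ 2 * expR (- (c / 2 * N%:R)) <= r / 2.
  by near: N; exact: E.
have N0 : 0 <= N%:R :> R by [].
set w := (N %/ q)%N; set d := Num.trunc (del' * N%:R) in H1.
set D := Num.trunc (del * N%:R).
have dD : (d <= D)%N by apply: le_truncn; rewrite ler_wpM2r //; lra.
have wN : (w <= N)%N by apply: leq_div.
have szw : 2 ^+ (i * w + w) <= L ^+ (i * w) * 2 ^+ N.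
  have P : (2 ^+ i) ^+ w <= (L ^+ i * 2 ^+ q.-1) ^+ w.
    by rewrite lerXn2r ?nnegrE ?mulr_ge0 ?exprn_ge0 ?sqrtr_ge0 ?sz.
  rewrite exprMn -!exprM in P.
  rewrite exprD; apply: (le_trans (ler_wpM2r (exprn_ge0 w (ler0n R 2)) P)).
  rewrite -mulrA -exprD ler_wpM2l ?exprn_ge0 ?sqrtr_ge0 // ler_weXn2l ?ler1n //.
  by apply: leq_trans (leq_divM N q); rewrite -/w -mulSnr prednK // mulnC.
rewrite mulSn addnC -(subnKC dD).
apply: (le_trans (unbalanced_count_step d (D - d) szw (ltW x0) x1)).
have -> : r * 2 ^+ N = r / 2 * 2 ^+ N + r / 2 * 2 ^+ N by field.
apply: lerD => //.
have e81 : 81 ^+ d <= expR (c / 2 * N%:R) :> R.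
  have : d%:R <= del' * N%:R by rewrite truncn_le mulr_ge0 // ltW.
  move=> dle; apply: (@le_trans _ _ (expR 80 ^+ d)).
    rewrite lerXn2r ?nnegrE ?expR_ge0 //.
    by apply: le_trans (expR_ge1Dx 80); lra.
  rewrite -expRM_natl ler_expR.
  by have := ler_wpM2r N0 d2; lra.
have ew : expR (2 * x ^+ 2 * w%:R - x * (D - d)%:R) <= expR (1 - c * N%:R).
  rewrite ler_expR natrB //.
  have : d%:R <= del' * N%:R by rewrite truncn_le mulr_ge0 // ltW.
  have : del * N%:R < D.+1%:R by rewrite truncnS_gt.
  have : w%:R <= N%:R :> R by rewrite ler_nat.
  rewrite -natr1 /c.
  move: (w%:R) (D%:R) (d%:R) (N%:R) N0 => w' D' d' n n0 h1 h2 h3.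
  have {}h3 : d' <= del / 2 * n by apply: le_trans h3 _; rewrite ler_wpM2r.
  have h4 : 2 * x ^+ 2 * w' <= 2 * x ^+ 2 * n.
    by rewrite ler_wpM2l // mulr_ge0 // sqr_ge0.
  have h5 : x * n * x <= x * n * (del / 8).
    by rewrite ler_wpM2l // mulr_ge0 // ltW.
  have h6 : x * (del / 2 * n - 1) <= x * (D' - d').
    by rewrite ler_wpM2l //; lra.
  nra.
have W : 81 ^+ d * expR (2 * x ^+ 2 * w%:R - x * (D - d)%:R) <=
    expR 1 * expR (- (c / 2 * N%:R)).
  apply: (le_trans (ler_pM _ _ e81 ew)); rewrite ?exprn_ge0 ?expR_ge0 //.
  by rewrite -!expRD ler_expR; lra.
have w1 : w.+1%:R <= N.+1%:R :> R by rewrite ler_nat.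
have k1 : (i * w).+1%:R <= i.+1%:R * N.+1%:R :> R.
  have := leq_mul (leqnn i) wN; rewrite -natrM ler_nat mulSn mulnS.
  by move: (i * w)%N (i * N)%N; clear; lia.
have kw : w.+1%:R * (i * w).+1%:R <= i.+1%:R * N.+1%:R ^+ 2 :> R.
  by rewrite expr2 mulrA mulrC ler_pM.
have kwW := ler_pM (mulr_ge0 (ler0n _ _) (ler0n _ _))
  (mulr_ge0 (exprn_ge0 d (ler0n R 81)) (expR_ge0 _)) kw W.
apply: le_trans (ler_wpM2r (exprn_ge0 N (ler0n R 2)) H2).
have := ler_wpM2r (exprn_ge0 N (ler0n R 2)) (ler_wpM2l (ler0n R 96) kwW).
by congr (_ <= _); ring.
Unshelve. all: by end_near.
Qed.

(** Five balanced steps at least halve a number: 2 L^5 = 18 L < 32. *)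
Lemma sqrt3X_five_le n : L ^+ (5 * n) * 2 ^+ n <= 2 ^+ (5 * n).
Proof.
rewrite !exprM -exprMn lerXn2r ?nnegrE ?mulr_ge0 ?exprn_ge0 ?sqrtr_ge0 //.
have -> : L ^+ 5 = L ^+ 2 * L ^+ 2 * L by ring.
by rewrite sqr_sqrt3; have := sqrt3_bounds; lra.
Qed.

(** The number of windows after which T^k m is typically below 2^(N / q). *)
Lemma last_window q : (0 < q)%N -> exists i,
  (forall i', (i' < i)%N -> 2 ^+ i' <= L ^+ i' * 2 ^+ q.-1) /\
  L ^+ i * 2 ^+ q.-1 < 2 ^+ i.
Proof.
move=> q0; have ex : exists i, L ^+ i * 2 ^+ q.-1 < 2 ^+ i.
  exists (5 * q)%N; apply: lt_le_trans (sqrt3X_five_le q).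
  by rewrite ltr_pM2l ?ltr_eXn2l ?ltr1n ?prednK // exprn_gt0.
case: (ex_minnP ex) => i Hi min_i; exists i; split=> // i' i'i.
by rewrite leNgt; apply/negP => /min_i; rewrite leqNgt i'i.
Qed.

(** The condition on K says that a balanced orbit starting near 2^N has not yet
    come down to 1.  Up to the last window, [rarely_unbalanced] applies; there the
    orbit is about 2^(N / q), so only about 5 N / q further steps, or fewer, lead
    to time K, and they add at most as much to the deviation. *)
Lemma mostly_balanced (del r : R) : 0 < del -> 0 < r ->
  \forall N \near \oo, forall K, 2 ^+ K <= L ^+ K * 2 ^+ N ->
    (unbalanced_count (Num.trunc (del * N%:R)) K N)%:R <= r * 2 ^+ N.
Proof.
move=> del0 r0; pose q := (Num.trunc (20 / del)).+1.
have q0 : (0 < q)%N by [].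
have q20 : 20 <= del * q%:R.
  by rewrite mulrC -ler_pdivrMr // ltW // truncnS_gt.
have [i [sz last_i]] := last_window q0.
have E := rarely_unbalanced q0 sz (divr_gt0 del0 (ltr0Sn _ 1)) r0.
near=> N => K HK.
have H : (unbalanced_count (Num.trunc (del / 2 * N%:R)) (i * (N %/ q)) N)%:R
      <= r * 2 ^+ N by near: N; exact: E.
have N1 : (5 * q + 5)%:R * 4 / del <= N%:R by near: N; exact: nbhs_infty_ger.
rewrite ler_pdivrMr // in N1.
apply: le_trans H; rewrite ler_nat.
set w := (N %/ q)%N; set k := (i * w)%N; set d := Num.trunc (del / 2 * _).
have Lp n : 0 < L ^+ n by rewrite exprn_gt0 // sqrt3_gt0.
have Nw : (N = q.-1 * w + (w + N %% q))%N.
  by rewrite addnA -mulSnr prednK // mulnC -divn_eq.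
have qN : (N %% q < q)%N by rewrite ltn_pmod.
(* Otherwise five (N - (q - 1) w + 1) more steps would fit before time K, and
   (L / 2)^K 2^N would be at most 1 / 2. *)
have Kk : (K - k <= 5 * w + 5 * q + 5)%N.
  rewrite leqNgt; apply/negP => lt; pose y := (w + N %% q).+1.
  pose z := (K - k - 5 * y)%N.
  have EK : K = (i * w + 5 * y + z)%N by rewrite -/k /z /y; lia.
  have A1 : L ^+ (i * w) * 2 ^+ (q.-1 * w) <= 2 ^+ (i * w).
    rewrite !exprM -exprMn lerXn2r ?nnegrE ?mulr_ge0 ?exprn_ge0 ?sqrtr_ge0 //.
    exact: ltW.
  have A2 := sqrt3X_five_le y.
  have A3 := sqrt3X_le2X z.
  have A12 := ler_pM (mulr_ge0 (ltW (Lp _)) (exprn_ge0 _ (ler0n _ 2)))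
    (mulr_ge0 (ltW (Lp _)) (exprn_ge0 _ (ler0n _ 2))) A1 A2.
  have := ler_pM (mulr_ge0 (mulr_ge0 (ltW (Lp _)) (exprn_ge0 _ (ler0n _ 2)))
    (mulr_ge0 (ltW (Lp _)) (exprn_ge0 _ (ler0n _ 2)))) (ltW (Lp _)) A12 A3.
  have -> : L ^+ (i * w) * 2 ^+ (q.-1 * w) * (L ^+ (5 * y) * 2 ^+ y) * L ^+ z =
     L ^+ K * 2 ^+ N.+1.
    have -> : N.+1 = (q.-1 * w + y)%N by rewrite [in LHS]Nw addnS.
    by rewrite EK !exprD; ring.
  rewrite -!exprD -EK => /le_trans/(_ HK).
  by rewrite ler_pM2l // leNgt ltr_eXn2l ?ltr1n ?ltnSn.
apply: subset_leq_card; apply/fintype.subsetP => m; rewrite !inE.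
apply: contraNN => /(balanced_extend K); apply: balanced_sub => //.
rewrite truncn_ge_nat ?mulr_ge0 ?(ltW del0) // natrD.
have dl : d%:R <= del / 2 * N%:R by rewrite truncn_le mulr_ge0 // divr_ge0 // ltW.
have Kk' : (K - k)%:R <= 5 * w%:R + (5 * q + 5)%:R :> R.
  by rewrite -natrM -natrD ler_nat addnA.
have wq : w%:R * q%:R <= N%:R :> R by rewrite -natrM ler_nat leq_divM.
have : 20 * w%:R <= del * q%:R * w%:R by rewrite ler_wpM2r.
have := ler_wpM2l (ltW del0) wq.
lra.
Unshelve. all: by end_near.
Qed.

(** * Descent of balanced orbits *)

(** The time of the theorem, without logarithms: it is the last K with
    (L / 2)^K m >= 1. *)
Lemma iterations_bounds m : (0 < m)%N ->
  2 ^+ iterations R m <= L ^+ iterations R m * m%:R /\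
  L ^+ (iterations R m).+1 * m%:R < 2 ^+ (iterations R m).+1.
Proof.
move=> m0; rewrite /iterations /log2.
have ln2 : 0 < ln 2 :> R by rewrite ln_gt0 // ltr1n.
have Lb := sqrt3_bounds.
have L0 := sqrt3_gt0.
have mR : 0 < m%:R :> R by rewrite ltr0n.
have g0 : 0 < ln 2 - ln L by rewrite subr_gt0 ltr_ln ?posrE //; lra.
have -> : 1 - ln L / ln 2 = (ln 2 - ln L) / ln 2 by field; rewrite gt_eqF.
have -> : ln m%:R / ln 2 / ((ln 2 - ln L) / ln 2) = ln m%:R / (ln 2 - ln L).
  by field; rewrite !gt_eqF.
set x := _ / (_ - _).
have x0 : 0 <= x by rewrite divr_ge0 ?(ltW g0) // ln_ge0 // ler1n.
have f0 : 0 <= Num.floor x by rewrite floor_ge_int_tmp.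
have KE : (`|Num.floor x|%N)%:R = (Num.floor x)%:~R :> R.
  by rewrite -{2}(gez0_abs f0).
have lnL n : ln (L ^+ n * m%:R) = n%:R * ln L + ln m%:R.
  by rewrite lnM ?posrE ?exprn_gt0 // lnXn // mulr_natl.
have ln2n n : ln (2 ^+ n) = n%:R * ln 2 :> R by rewrite lnXn // mulr_natl.
split.
  rewrite -ler_ln ?posrE ?mulr_gt0 ?exprn_gt0 // lnL ln2n KE.
  have : (Num.floor x)%:~R <= x by exact: floor_le_tmp.
  by rewrite ler_pdivlMr //; lra.
rewrite -ltr_ln ?posrE ?mulr_gt0 ?exprn_gt0 // lnL ln2n -natr1 KE.
have : x < (Num.floor x)%:~R + 1 by rewrite -intrD1 floorD1_gt.
by rewrite ltr_pdivrMr //; lra.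
Qed.

Lemma iterations_le m n : (0 < m)%N -> (m <= n)%N ->
  (iterations R m <= iterations R n)%N.
Proof.
move=> m0 mn; rewrite leqNgt; apply/negP => lt.
have [A _] := iterations_bounds m0.
have [_ B] := iterations_bounds (leq_trans m0 mn).
have L0 := sqrt3_gt0.
move: (iterations R m) (iterations R n) lt A B => K K' lt A B.
have mnR : m%:R <= n%:R :> R by rewrite ler_nat.
have {}A := le_trans A (ler_wpM2l (exprn_ge0 K (ltW L0)) mnR).
rewrite -(subnKC lt) !exprD in A.
have C := sqrt3X_le2X (K - K'.+1).
have p2 : 0 < 2 ^+ (K - K'.+1) :> R by rewrite exprn_gt0.
have D := ler_wpM2l (mulr_ge0 (exprn_ge0 K'.+1 (ltW L0)) (ler0n R n)) C.
rewrite -(ltr_pM2r p2) in B.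
lra.
Qed.

(** At that time (L / 2)^K m <= 2, so that T^K m is at most 6 * 3^d, where d is
    small compared with eps N and hence with eps log m. *)
Lemma balanced_descent (eps : R) : 0 < eps ->
  \forall N \near \oo, forall m, (2 ^ N./2 <= m)%N ->
    balanced (Num.trunc (eps / 16 * N%:R)) (iterations R m) m ->
    (iter (iterations R m) T m)%:R <= (m%:R : R) `^ eps.
Proof.
move=> eps0; near=> N => m mN; set d := Num.trunc _ => bal.
have N1 : 8 * (5 + eps / 4) / eps <= N%:R by near: N; exact: nbhs_infty_ger.
rewrite ler_pdivrMr // in N1.
have m0 : (0 < m)%N by apply: leq_trans mN; rewrite expn_gt0.
have [_ B] := iterations_bounds m0.
have U := iter_T_le bal.
move: (iterations R m) bal B U => K bal B U.
have p2 : 0 < 2 ^+ K :> R by rewrite exprn_gt0.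
have L1 := sqrt3_ge1.
have {}B : L ^+ K * m%:R <= 2 * 2 ^+ K.
  rewrite exprS [2 ^+ _]exprS in B; apply: le_trans (ltW B).
  by rewrite -mulrA ler_peMl // mulr_ge0 // exprn_ge0 // sqrtr_ge0.
have Ld := sqrt3X_le3X d.
have {U}U : (iter K T m)%:R <= 6 * 3 ^+ d :> R.
  rewrite -(ler_pM2l p2); apply: (le_trans U).
  have := ler_pM (mulr_ge0 (exprn_ge0 K (sqrtr_ge0 _)) (ler0n R m))
    (exprn_ge0 d (sqrtr_ge0 _)) B Ld.
  by rewrite exprD mulrAC; lra.
apply: (le_trans U); rewrite /powR pnatr_eq0 gtn_eqF //.
have dl : d%:R <= eps / 16 * N%:R by rewrite truncn_le mulr_ge0 // divr_ge0 // ltW.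
have A : 6 * 3 ^+ d <= expR (5 + 2 * d%:R) :> R.
  rewrite expRD ler_pM ?exprn_ge0 //.
    by apply: le_trans (expR_ge1Dx 5); lra.
  rewrite mulrC expRM_natl lerXn2r ?nnegrE ?expR_ge0 //.
  by apply: le_trans (expR_ge1Dx 2); lra.
apply: (le_trans A); rewrite ler_expR.
have ln2 : 1 / 2 <= ln 2 :> R.
  rewrite -ler_expR lnK ?posrE //.
  have : 1 / 2 <= expR (- (1 / 2)) :> R by apply: le_trans (expR_ge1Dx _); lra.
  rewrite expRN => /(ler_wpM2r (expR_ge0 (1 / 2))).
  by rewrite mulVf ?gt_eqF ?expR_gt0 //; lra.
have lnm : (N%:R - 1) / 4 <= ln (m%:R : R).
  have : ln (2 ^+ N./2) <= ln (m%:R : R).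
    by rewrite ler_ln ?posrE ?exprn_gt0 ?ltr0n // -natrX ler_nat.
  rewrite lnXn // -[_ *+ N./2]mulr_natl.
  have : (N <= 2 * N./2 + 1)%N by lia.
  rewrite -(ler_nat R) natrD natrM; have := ler_wpM2l (ler0n R N./2) ln2.
  by move: (N./2)%:R (ln m%:R) => a b; lra.
have := ler_wpM2l (ltW eps0) lnm; lra.
Unshelve. all: by end_near.
Qed.

End RealBounds.

(** * Natural density *)

Lemma card_ord_count (P : pred nat) M :
  #|[set m : 'I_M | P m]%SET| = count P (iota 0 M).
Proof. by rewrite cardsE cardE /enum_mem size_filter -enumT -val_enum_ord count_map. Qed.

Lemma count_upto_count (A : set nat) n : A `<=` [set m | (0 < m)%N] ->
  count_upto A n = count (fun m => `[< A m >]) (iota 1 n).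
Proof.
move=> Apos; rewrite /count_upto -size_filter.
set s := [seq m <- iota 1 n | `[< A m >]].
have us : uniq s by rewrite filter_uniq ?iota_uniq.
have -> : fset_set [set m | A m /\ (m <= n)%N] = [fset m in s]%fset.
  rewrite -[RHS]set_fsetK; congr fset_set.
  apply/seteqP; split=> m /=; rewrite !inE mem_filter mem_iota add1n ltnS.
    by move=> [Am mn]; apply/and3P; split=> //; [exact/asboolP | exact: Apos].
  by case/and3P=> /asboolP.
by rewrite card_fseq undup_id.
Qed.

(** The exceptions up to n are among those below the next power of two, which is
    at most 2 n. *)
Lemma natural_density_one_dyadic (R : realType) (A : set nat) :
  A `<=` [set m | (0 < m)%N] ->
  (forall r : R, 0 < r -> \forall N \near \oo,
    #|[set m : 'I_(2 ^ N) | (0 < m)%N && ~~ `[< A m >]]%SET|%:R <= r * 2 ^+ N) ->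
  natural_density_one R A.
Proof.
move=> Apos H; split=> //; apply: (cvg_limn_einf_sup _).1.
apply: cvg_EFin; first by near=> n.
apply/cvgrPdist_le => r r0.
have [N0 _ HN] := H (r / 2) (divr_gt0 r0 (ltr0Sn _ 1)).
near=> n.
have n0 : (0 < n)%N by near: n; exact: nbhs_infty_ge.
have nN0 : (2 ^ N0 <= n)%N by near: n; exact: nbhs_infty_ge.
pose N := (trunc_log 2 n).+1.
have /andP[N1 N2] : (2 ^ N.-1 <= n < 2 ^ N)%N by apply: trunc_log_bounds.
have N0N : (N0 <= N)%N by rewrite ltnW // ltnS trunc_log_max.
have {HN}B := HN N N0N.
rewrite /= count_upto_count //.
have E := count_predC (fun m => `[< A m >]) (iota 1 n).
rewrite size_iota in E.
have C : (count (predC (fun m => `[< A m >])) (iota 1 n) <=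
    #|[set m : 'I_(2 ^ N) | (0 < m)%N && ~~ `[< A m >]]%SET|)%N.
  rewrite (card_ord_count (fun m => (0 < m)%N && ~~ `[< A m >])).
  rewrite -(subnKC N2) iotaD count_cat; apply: leq_trans (leq_addr _ _).
  rewrite /= add0n; apply: eq_leq; apply: eq_in_count => m.
  by rewrite mem_iota /= => /andP[->].
have nR : 0 < n%:R :> R by rewrite ltr0n.
have -> : 1 - (count (fun m => `[< A m >]) (iota 1 n))%:R / n%:R =
   (count (predC (fun m => `[< A m >])) (iota 1 n))%:R / n%:R :> R.
  have := congr1 (fun k => k%:R : R) E; rewrite natrD => <-.
  by field; rewrite -natrD E gt_eqF.
rewrite ger0_norm ?divr_ge0 // ler_pdivrMr //.
apply: (@le_trans _ _ (r / 2 * 2 ^+ N)).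
  by apply: le_trans B; rewrite ler_nat.
have : 2 ^+ N.-1 <= n%:R :> R by rewrite -natrX ler_nat.
rewrite /N exprS /= => /(ler_wpM2l (ltW r0)); lra.
Unshelve. all: by end_near.
Qed.

Lemma near_pow_half (R : realType) (r : R) : 0 < r ->
  \forall N \near \oo, (2 ^ N./2)%:R <= r * 2 ^+ N.
Proof.
move=> r0; near=> N.
have N1 : 2 / r <= N%:R by near: N; exact: nbhs_infty_ger.
rewrite ler_pdivrMr // in N1.
have -> : 2 ^+ N = 2 ^+ (N - N./2) * 2 ^+ N./2 :> R.
  by rewrite -exprD subnK //; lia.
rewrite natrX mulrA ler_peMl ?exprn_ge0 //.
have : (N <= 2 * 2 ^ (N - N./2))%N.
  by have := ltn_expl (N - N./2) (ltnSn 1); lia.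
rewrite -(ler_nat R) natrM natrX => /(ler_wpM2l (ltW r0)); lra.
Unshelve. all: by end_near.
Qed.

Theorem corollary1p4 (R : realType) (eps : R) (heps : 0 < eps) :
  natural_density_one R
    [set m : nat | (0 < m)%N /\
                   (iter (iterations R m) T m)%:R <= (m%:R : R) `^ eps].
Proof.
apply: natural_density_one_dyadic => [m []//|r r0].
have r2 : 0 < r / 2 by rewrite divr_gt0.
have eps16 : 0 < eps / 16 by rewrite divr_gt0.
near=> N.
have small : (2 ^ N./2)%:R <= r / 2 * 2 ^+ N.
  by near: N; exact: near_pow_half.
have descent : forall m, (2 ^ N./2 <= m)%N ->
    balanced (Num.trunc (eps / 16 * N%:R)) (iterations R m) m ->
    (iter (iterations R m) T m)%:R <= (m%:R : R) `^ eps.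
  by near: N; exact: balanced_descent.
have atypical : forall K, 2 ^+ K <= Num.sqrt (3 : R) ^+ K * 2 ^+ N ->
    (unbalanced_count (Num.trunc (eps / 16 * N%:R)) K N)%:R <= r / 2 * 2 ^+ N.
  by near: N; exact: mostly_balanced.
have [K_le _] := iterations_bounds R (expn_gt0 2 N : (0 < 2 ^ N)%N).
rewrite natrX in K_le; have {}atypical := atypical _ K_le.
set K := iterations R (2 ^ N) in atypical; set d := Num.trunc _ in descent atypical.
have -> : r * 2 ^+ N = r / 2 * 2 ^+ N + r / 2 * 2 ^+ N by field.
apply: le_trans (lerD small atypical).
(* An exception m < 2^N is below 2^(N/2), or unbalanced up to the time of 2^N,
   which is at least the time of m. *)
rewrite -natrD ler_nat -[X in (_ <= X + _)%N]card_ord.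
pose S := [set m : 'I_(2 ^ N) | (m < 2 ^ N./2)%N]%SET.
have cS : (#|S| <= #|'I_(2 ^ N./2)|)%N.
  have hN : (2 ^ N./2 <= 2 ^ N)%N by rewrite leq_exp2l //; lia.
  apply: leq_trans (leq_imset_card (widen_ord hN) _).
  apply: subset_leq_card; apply/fintype.subsetP => m; rewrite inE => mh.
  by apply/imsetP; exists (Ordinal mh) => //; apply: val_inj.
apply: leq_trans (leq_add cS (leqnn _)); apply: leq_trans (leq_card_setU _ _).1.
apply: subset_leq_card; apply/fintype.subsetP => m; rewrite !inE.
case/andP=> m0 /asboolPn nA; rewrite ltnNge -negb_and.
apply/negP => /andP[Nm bal]; apply: nA; split=> //.
apply: descent => //; apply: balanced_sub bal => //.
by rewrite iterations_le // ltnW.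
Unshelve. all: by end_near.
Qed.
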